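(* Let $k$ be an algebraically closed field of characteristic zero and let $B \subset A$ be an extension of finite dimensional semisimple $k$-algebras. Then $B \subset A$ is a depth one extension if and only if $\mathcal{Z}(B) \subset \mathcal{Z}(A)$.
   Context: For a $k$-algebra $R$, $\mathcal{Z}(R)$ denotes the center of $R$. An extension of $k$-algebras $B \subset A$ (that is, $B$ is a unital subalgebra of $A$) is said to have depth one (to be a depth one extension) if there exists a positive integer $n$ such that $A$ is isomorphic to a direct summand of $B^n$ as a $B$-$B$-bimodule, i.e. in the category ${}_B\mathrm{Mod}_B$. *)

(* Defs.v *)
From HB Require Import structures.
From mathcomp Require Import all_boot all_algebra all_field.

Set Implicit Arguments.
Unset Strict Implicit.
Unset Printing Implicit Defensive.

Import GRing.Theory.

Local Open Scope ring_scope.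

(* All left ideals of a finite dimensional unital algebra are k-subspaces, so
   {vspace R} is the right type for them. *)

Definition left_ideal (k : fieldType) (R : falgType k) (I : {vspace R}) : Prop :=
  forall a x : R, x \in I -> a * x \in I.

Definition simple_left_ideal (k : fieldType) (R : falgType k)
    (I : {vspace R}) : Prop :=
  [/\ left_ideal I, I != 0%VS
    & forall J : {vspace R}, left_ideal J -> (J <= I)%VS -> J = 0%VS \/ J = I].

Definition semisimple_algebra (k : fieldType) (R : falgType k) : Prop :=
  exists (m : nat) (S : 'I_m -> {vspace R}),
    [/\ forall i, simple_left_ideal (S i),
        directv (\sum_(i < m) S i)
      & (\sum_(i < m) S i)%VS = fullv].

(* R-R-bimodules over a k-algebra R. Since both actions are k-bilinear and
   unital, k acts in the same way on the left, on the right, and through the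
   vector space structure. *)
Record bimodule (k : fieldType) (R : algType k) := Bimodule {
  bimod_sort :> lmodType k;
  lact : R -> bimod_sort -> bimod_sort;
  ract : bimod_sort -> R -> bimod_sort;
  lact_linearl : forall x, linear (lact^~ x);
  lact_linearr : forall b, linear (lact b);
  ract_linearl : forall b, linear (ract^~ b);
  ract_linearr : forall x, linear (ract x);
  lact1 : forall x, lact 1 x = x;
  lactM : forall b c x, lact (b * c) x = lact b (lact c x);
  ract1 : forall x, ract x 1 = x;
  ractM : forall x b c, ract x (b * c) = ract (ract x b) c;
  lractA : forall b x c, ract (lact b x) c = lact b (ract x c)
}.

Definition bimod_iso (k : fieldType) (R : algType k) (M N : bimodule R) : Prop :=
  exists f : {linear M -> N},
    [/\ bijective f,
        forall b x, f (lact b x) = lact b (f x)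
      & forall x b, f (ract x b) = ract (f x) b].

Section Constructions.

Variables (k : fieldType) (R : algType k).

Definition regular_bimod : bimodule R.
Proof.
refine (@Bimodule k R R (fun b x => b * x) (fun x b => x * b)
          _ _ _ _ _ _ _ _ _) => /=.
- by move=> x c b d; rewrite mulrDl scalerAl.
- by move=> b c x y; rewrite mulrDr scalerAr.
- by move=> b c x y; rewrite mulrDl scalerAl.
- by move=> x c b d; rewrite mulrDr scalerAr.
- exact: mul1r.
- by move=> b c x; rewrite mulrA.
- exact: mulr1.
- by move=> x b c; rewrite mulrA.
- by move=> b x c; rewrite mulrA.
Defined.

Definition sum_bimod (M N : bimodule R) : bimodule R.
Proof.
refine (@Bimodule k R (M * N)%type
          (fun b x => (lact b x.1, lact b x.2))
          (fun x b => (ract x.1 b, ract x.2 b)) _ _ _ _ _ _ _ _ _) => /=.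
- by move=> [x y] c b d; congr pair; apply: lact_linearl.
- by move=> b c [x y] [z t]; congr pair; apply: lact_linearr.
- by move=> b c [x y] [z t]; congr pair; apply: ract_linearl.
- by move=> [x y] c b d; congr pair; apply: ract_linearr.
- by move=> [x y]; rewrite !lact1.
- by move=> b c [x y]; rewrite !lactM.
- by move=> [x y]; rewrite !ract1.
- by move=> [x y] b c; rewrite !ractM.
- by move=> b [x y] c; rewrite !lractA.
Defined.

Definition power_bimod (M : bimodule R) (n : nat) : bimodule R.
Proof.
refine (@Bimodule k R {ffun 'I_n -> M}
          (fun b x => [ffun i => lact b (x i)])
          (fun x b => [ffun i => ract (x i) b]) _ _ _ _ _ _ _ _ _) => /=.
- by move=> x c b d; apply/ffunP=> i; rewrite !ffunE; apply: lact_linearl.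
- by move=> b c x y; apply/ffunP=> i; rewrite !ffunE; apply: lact_linearr.
- by move=> b c x y; apply/ffunP=> i; rewrite !ffunE; apply: ract_linearl.
- by move=> x c b d; apply/ffunP=> i; rewrite !ffunE; apply: ract_linearr.
- by move=> x; apply/ffunP=> i; rewrite !ffunE lact1.
- by move=> b c x; apply/ffunP=> i; rewrite !ffunE lactM.
- by move=> x; apply/ffunP=> i; rewrite !ffunE ract1.
- by move=> x b c; apply/ffunP=> i; rewrite !ffunE ractM.
- by move=> b x c; apply/ffunP=> i; rewrite !ffunE lractA.
Defined.

End Constructions.

Definition iso_direct_summand (k : fieldType) (R : algType k)
    (M P : bimodule R) : Prop :=
  exists N : bimodule R, bimod_iso P (sum_bimod M N).

(* An {aspace A} may have an identity other than 1; 1 \in B makes B a unital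
   subalgebra, which is what makes the action of B on A unital. *)
Definition extension_bimod (k : fieldType) (A : falgType k) (B : {aspace A})
  (B1 : 1 \in B) : bimodule (subvs_of B).
Proof.
refine (@Bimodule k (subvs_of B) A (fun b x => vsval b * x)
          (fun x b => x * vsval b) _ _ _ _ _ _ _ _ _) => /=.
- by move=> x c b d; rewrite linearP mulrDl scalerAl.
- by move=> b c x y; rewrite mulrDr scalerAr.
- by move=> b c x y; rewrite mulrDl scalerAl.
- by move=> x c b d; rewrite linearP mulrDr scalerAr.
- by move=> x; rewrite (_ : algid B = 1) ?mul1r //; apply/eqP; rewrite algid_eq1.
- by move=> b c x; rewrite mulrA.
- by move=> x; rewrite (_ : algid B = 1) ?mulr1 //; apply/eqP; rewrite algid_eq1.
- by move=> x b c; rewrite mulrA.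
- by move=> b x c; rewrite mulrA.
Defined.

Definition depth_one (k : fieldType) (A : falgType k) (B : {aspace A})
    (B1 : 1 \in B) : Prop :=
  exists2 n : nat, (0 < n)%N &
    iso_direct_summand (extension_bimod B1)
      (power_bimod (regular_bimod (subvs_of B)) n).

(* Main.v *)
From HB Require Import structures.
Require Import Defs.
From mathcomp Require Import all_boot all_algebra all_field ring.

(** If A is a direct summand of B^n, then every z in Z(B) acts in the same way
    on both sides of B^n, hence on both sides of A, that is, z is in Z(A).

    For the converse, consider the regular trace form t(a b) of B, where t(a) is
    the trace of left multiplication by a. In characteristic 0 an endomorphism
    all of whose positive powers have trace 0 is nilpotent, so the radical of
    the form is a nil left ideal, and such an ideal annihilates every simple
    left ideal: as B is semisimple, the form is nondegenerate
    ([regtrace_nondegenerate]). It therefore has dual bases x_i, y_i, and the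
    tensor sum_i x_i (x) y_i is B-invariant ([casimir_swap]). Hence
    E(a) = sum_i x_i a y_i maps A to the centraliser C of B in A, and a direct
    computation gives

      sum_i x_i E(y_i a) = sum_(i, j) x_j x_i y_j a y_i
                         = sum_i E(x_i) a y_i = a m,  m = sum_i E(x_i) y_i,

    because the elements E(x_i) of Z(B) commute with a when Z(B) is contained
    in Z(A) ([casimir_reconstruction]). The element m of Z(B) is invertible:
    for w in Z(B) with m w = 0, the positive powers of the endomorphism
    b |-> w E(b) of B have trace 0, so w is nilpotent and thus 0
    ([casimir_value_regular], [casimir_value_central_inverse]).

    Finally let c_j be a basis of C, with coordinate forms f_j. The maps
    h_j(a) = sum_i f_j(E(y_i a)) x_i are B-B-bimodule maps from A to B, again
    by invariance, and a = sum_j h_j(a) c_j m^-1. So the bimodule map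
    (b_j) |-> sum_j b_j c_j m^-1 from B^n to A is split by (h_j), and A is a
    direct summand of B^n ([split_direct_summand]). *)

Set Implicit Arguments.
Unset Strict Implicit.
Unset Printing Implicit Defensive.

Import GRing.Theory VectorInternalTheory.

Local Open Scope ring_scope.

(** * Traces and nilpotency in characteristic zero *)

Section TraceNilpotency.

Variables (F : fieldType) (charF : [pchar F] =i pred0).

(** A rank factorisation E = C R of an idempotent satisfies R C = 1, and the
    trace of C R is that of R C, an identity matrix of size the rank. *)
Lemma mxtrace_idem n (E : 'M[F]_n) : E *m E = E -> \tr E = (\rank E)%:R.
Proof.
move=> EE; have := mulmx_base E.
move: (col_base_full E) (row_base_free E).
move: (col_base E) (row_base E) => C R Cfull Rfree defE.
have RC1 : R *m C = 1%:M.
  apply: (row_full_inj Cfull); apply: (row_free_inj Rfree).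
  by rewrite /= mulmx1 mulmxA -mulmxA defE EE.
by rewrite -[in LHS]defE mxtrace_mulC RC1 mxtrace1.
Qed.

(** Factor the characteristic polynomial as q X^a with q(0) != 0, and let
    u X^(a+1) + v q = 1. Then e = u X^(a+1) evaluates at M to the Fitting
    projection onto the part where M is invertible. It is idempotent, and its
    trace is 0 as e is divisible by X; so its rank is 0 in characteristic 0.
    With e(M) = 0, the matrix M^a is the value at M of v q X^a, which is 0. *)
Lemma mxtrace_exp0_nilpotent n (M : 'M[F]_n) :
  (forall i, \tr (M ^+ i.+1) = 0) -> exists m, M ^+ m = 0.
Proof.
case: n M => [|n] M trM0; first by exists 0; apply/matrixP=> [[]].
have tr_hornerX (r : {poly F}) : \tr (horner_mx M (r * 'X)) = 0.
  rewrite -{1}(coefK r) poly_def mulr_suml !raddf_sum big1 //= => i _.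
  by rewrite -scalerAl -exprSr !linearZ /= rmorphXn /= horner_mx_X trM0 mulr0.
have [a [q q0 Dp]] := multiplicity_XsubC (char_poly M) 0.
rewrite monic_neq0 ?char_poly_monic //= in q0; rewrite subr0 in Dp.
have : coprimep ('X ^+ a.+1) q.
  by rewrite coprimep_expl // coprimep_sym -['X]subr0 coprimep_XsubC.
case/Bezout_eq1_coprimepP=> [[u v] /= uv1].
have pM0 : horner_mx M (q * 'X ^+ a) = 0 by rewrite -Dp Cayley_Hamilton.
have eM0 : horner_mx M (u * 'X ^+ a.+1) = 0.
  have idem : horner_mx M (u * 'X ^+ a.+1) *m horner_mx M (u * 'X ^+ a.+1) =
    horner_mx M (u * 'X ^+ a.+1).
    apply/eqP; rewrite mulmxE -subr_eq0 -rmorphM -rmorphB /=.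
    have -> : u * 'X ^+ a.+1 * (u * 'X ^+ a.+1) - u * 'X ^+ a.+1
        = (q * 'X ^+ a) * - (u * 'X * v).
      by rewrite -[X in _ - X]mulr1 -uv1 exprSr; ring.
    by rewrite rmorphM /= pM0 mul0r.
  have /eqP := mxtrace_idem idem; rewrite {1}exprSr mulrA tr_hornerX eq_sym.
  by have /pcharf0P -> := charF; rewrite mxrank_eq0 => /eqP.
exists a; rewrite -[LHS]mul1r -(rmorph1 (horner_mx M)) -uv1.
rewrite rmorphD /= eM0 add0r.
by rewrite -{2}[M]horner_mx_X -rmorphXn -rmorphM /= -mulrA rmorphM /= pM0 mulr0.
Qed.

Variable V : vectType F.

Definition lftrace (f : 'End(V)) : F := \tr (f2mx f).

Lemma v2r_lfun (f : 'End(V)) v : v2r (f v) = v2r v *m f2mx f.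
Proof. by rewrite unlock /= r2vK. Qed.

Lemma v2r_sum_delta (v : V) :
  v = \sum_i v2r v 0 i *: r2v (delta_mx 0 i).
Proof.
rewrite -{1}[v]v2rK [v2r v in LHS]row_sum_delta linear_sum.
by apply: eq_bigr => i _; rewrite linearZ.
Qed.

Lemma lftraceE (f : 'End(V)) :
  lftrace f = \sum_i v2r (f (r2v (delta_mx 0 i))) 0 i.
Proof. by apply: eq_bigr => i _; rewrite v2r_lfun r2vK -rowE mxE. Qed.

Lemma f2mx_comp (f g : 'End(V)) : f2mx (f \o g)%VF = f2mx g *m f2mx f.
Proof.
apply/row_matrixP=> i; rewrite !rowE mulmxA -[delta_mx _ _]r2vK.
by rewrite -!v2r_lfun comp_lfunE.
Qed.

Lemma lftrace_comp (f g : 'End(V)) : lftrace (f \o g)%VF = lftrace (g \o f)%VF.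
Proof. by rewrite /lftrace !f2mx_comp mxtrace_mulC. Qed.

Lemma lftrace_nilpotent (f : 'End(V)) :
    (forall i (g : 'End(V)), g =1 iter i.+1 f -> lftrace g = 0) ->
  exists m, forall v, iter m f v = 0.
Proof.
have iterE i v : v2r (iter i f v) = v2r v *m (f2mx f) ^+ i.
  by elim: i => [|i IHi]; rewrite ?mulmx1 //= v2r_lfun IHi -mulmxA exprSr.
move=> tr0; have [i|m fm0] := @mxtrace_exp0_nilpotent _ (f2mx f).
  have <- := tr0 i (Hom (f2mx f ^+ i.+1)) => // v.
  by apply: v2r_inj; rewrite v2r_lfun iterE.
by exists m => v; apply: v2r_inj; rewrite iterE fm0 mulmx0 linear0.
Qed.

Lemma lftrace_is_scalar : scalar (@lftrace).
Proof.
move=> c f g; rewrite !lftraceE mulr_sumr -big_split /=; apply: eq_bigr => i _.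
by rewrite add_lfunE scale_lfunE linearP !mxE.
Qed.
HB.instance Definition _ :=
  GRing.isLinear.Build F 'End(V) F _ lftrace lftrace_is_scalar.

End TraceNilpotency.

(** * The regular trace form of a semisimple algebra *)

Section RegularTrace.

Variables (F : fieldType) (R : falgType F).

Definition regtrace (a : R) : F := lftrace (amull a).

Lemma regtrace_is_scalar : scalar regtrace.
Proof. by move=> c a b; rewrite /regtrace !linearP. Qed.
HB.instance Definition _ :=
  GRing.isLinear.Build F R F _ regtrace regtrace_is_scalar.

Lemma regtraceC (a b : R) : regtrace (a * b) = regtrace (b * a).
Proof.
have amull_comp u v : amull (u * v) = (amull u \o amull v)%VF :> 'End(R).
  by apply/lfunP=> w; rewrite comp_lfunE !lfunE /= mulrA.
by rewrite /regtrace !amull_comp lftrace_comp.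
Qed.

(** A nil left ideal N annihilates each simple left ideal S i, whence it kills
    1: for s in S i, the left ideal N s is 0 or S i, and in the latter case some
    nilpotent b in N fixes s, so that s = 0. *)
Lemma semisimple_nil_left_ideal (N : {vspace R}) :
    semisimple_algebra R -> left_ideal N ->
    (forall a, a \in N -> exists m, a ^+ m = 0) ->
  N = 0%VS.
Proof.
move=> [m [S [simS _ fullS]]] idN nilN.
have NS0 i a s : a \in N -> s \in S i -> a * s = 0.
  move=> Na Ss; have [idS _ minS] := simS i.
  have Ns_sub : (amulr s @: N <= S i)%VS.
    by apply/subvP=> _ /memv_imgP[b _ ->]; rewrite lfunE /=; apply: idS.
  have idNs : left_ideal (amulr s @: N)%VS.
    move=> b _ /memv_imgP[c Nc ->]; apply/memv_imgP.
    exists (b * c); first exact: idN.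
    by rewrite !lfunE /= mulrA.
  have Nas : a * s \in (amulr s @: N)%VS.
    by apply/memv_imgP; exists a; rewrite // lfunE.
  have [Ns0|NsS] := minS _ idNs Ns_sub.
    by apply/eqP; rewrite -memv0 -Ns0.
  move: (Ss); rewrite -NsS => /memv_imgP[b Nb]; rewrite lfunE /= => bs.
  have [k bk0] := nilN b Nb.
  have -> : s = b ^+ k * s; last by rewrite bk0 mul0r mulr0.
  by elim: k {bk0} => [|k IHk]; rewrite ?mul1r // exprSr -mulrA -bs.
apply/eqP; rewrite -subv0; apply/subvP=> a Na; rewrite memv0 -[a]mulr1.
have : 1 \in (\sum_(i < m) S i)%VS by rewrite fullS memvf.
case/memv_sumP=> s Ss ->; rewrite mulr_sumr big1 // => i _.
by apply: NS0 (Ss i _).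
Qed.

Hypothesis charF : [pchar F] =i pred0.
Hypothesis ssR : semisimple_algebra R.

Lemma semisimple_mul_nil_eq0 (a : R) :
  (forall b, exists m, (b * a) ^+ m = 0) -> a = 0.
Proof.
move=> nil_a; apply/eqP; rewrite -memv0.
rewrite -(@semisimple_nil_left_ideal (amulr a @: fullv)%VS) //.
- by apply/memv_imgP; exists 1; rewrite ?memvf // lfunE /= mul1r.
- move=> b _ /memv_imgP[c _ ->]; apply/memv_imgP.
  exists (b * c); rewrite ?memvf //.
  by rewrite !lfunE /= mulrA.
by move=> _ /memv_imgP[b _ ->]; rewrite lfunE; apply: nil_a.
Qed.

(** If a is in the radical of the form, then so are the elements b a; the
    positive powers of b a have trace 0, and b a is nilpotent. *)
Lemma regtrace_nondegenerate (a : R) :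
  (forall b, regtrace (a * b) = 0) -> a = 0.
Proof.
move=> ta0; apply: semisimple_mul_nil_eq0 => b.
have iterE i : iter i (amull (b * a)) =1 ( *%R ((b * a) ^+ i)).
  elim: i => [|i IHi] v; first by rewrite mul1r.
  by rewrite iterS IHi lfunE /= mulrA -exprS.
have [i g gE|m nil_m] := @lftrace_nilpotent _ charF _ (amull (b * a)).
  have -> : g = amull ((b * a) ^+ i.+1).
    by apply/lfunP=> v; rewrite gE iterE lfunE.
  by rewrite -/(regtrace _) exprS -mulrA regtraceC -mulrA ta0.
by exists m; rewrite -[_ ^+ m]mulr1 -iterE.
Qed.

(** The inverse of the Gram matrix of the standard basis of R provides elements
    that represent the coordinate forms. *)
Lemma regtrace_coord :
  exists y : 'I_(dim R) -> R, forall a i, v2r a 0 i = regtrace (a * y i).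
Proof.
pose x i : R := r2v (delta_mx 0 i).
have xE (a : R) : a = \sum_i v2r a 0 i *: x i by apply: v2r_sum_delta.
pose G := \matrix_(i, j) regtrace (x i * x j).
have GE a j : (v2r a *m G) 0 j = regtrace (a * x j).
  rewrite mxE {2}[a]xE mulr_suml linear_sum; apply: eq_bigr => i _.
  by rewrite !mxE -scalerAl linearZ.
have Gu : G \in unitmx.
  rewrite -row_free_unit; apply: inj_row_free => v vG0.
  apply: (can_inj r2vK); rewrite linear0; apply: regtrace_nondegenerate => b.
  rewrite [b]xE mulr_sumr linear_sum big1 // => j _.
  by rewrite -scalerAr linearZ /= -GE r2vK vG0 mxE mulr0.
exists (fun i => \sum_j invmx G j i *: x j) => a i.
rewrite -[v2r a](mulmxK Gu) mxE mulr_sumr linear_sum.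
by apply: eq_bigr => j _; rewrite GE -scalerAr linearZ mulrC.
Qed.

End RegularTrace.

Lemma linear_combination (F : fieldType) (U V : lmodType F) (f : U -> V) n
    (c : 'I_n -> F) (u : 'I_n -> U) :
  linear f -> f (\sum_i c i *: u i) = \sum_i c i *: f (u i).
Proof.
move=> lin_f; pose fM := GRing.isLinear.Build F U V _ f lin_f.
pose g : {linear U -> V} := HB.pack f fM.
by rewrite -[f]/(g : U -> V) linear_sum; apply: eq_bigr => i _; rewrite linearZ.
Qed.

(** The two halves are equivalent when the regular trace form is nondegenerate;
    recording both makes the Casimir tensor usable on either factor. *)
Definition dual_bases (F : fieldType) (R : falgType F) n (x y : 'I_n -> R) :=
  (forall a, a = \sum_i regtrace (a * y i) *: x i)
  /\ (forall a, a = \sum_i regtrace (x i * a) *: y i).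

Lemma semisimple_dual_bases (F : fieldType) (R : falgType F) :
    [pchar F] =i pred0 -> semisimple_algebra R ->
  exists n (x y : 'I_n -> R), dual_bases x y
    /\ forall f : 'End(R), lftrace f = \sum_i regtrace (f (x i) * y i).
Proof.
move=> charF ssR; have [y yE] := regtrace_coord charF ssR.
pose x i : R := r2v (delta_mx 0 i); exists (dim R), x, y.
have dualx a : a = \sum_i regtrace (a * y i) *: x i.
  by rewrite [LHS]v2r_sum_delta; apply: eq_bigr => i _; rewrite yE.
split; last by move=> f; rewrite lftraceE; apply: eq_bigr => i _; rewrite yE.
split=> // a; apply/eqP; rewrite -subr_eq0; apply/eqP.
apply: (regtrace_nondegenerate charF ssR) => b.
rewrite regtraceC mulrBr linearB /=; apply/eqP.
rewrite subr_eq0 {1}[b]dualx; apply/eqP.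
rewrite mulr_suml mulr_sumr !linear_sum; apply: eq_bigr => i _.
by rewrite -scalerAl -scalerAr !linearZ /= mulrC.
Qed.

(** * The Casimir tensor and the projection onto a centraliser *)

Section Casimir.

Variables (F : fieldType) (R : falgType F) (n : nat) (x y : 'I_n -> R).
Hypothesis dual_xy : dual_bases x y.

(** Invariance of the Casimir tensor sum_i x_i (x) y_i, tested on bilinear maps:
    a factor on the outside of x_i may be moved to the outside of y_i, and one
    on the inside to the inside. Both sides have the coefficient
    t(b x_i c y_j) at the term of index (i, j) after expansion. *)
Lemma casimir_swap (V : lmodType F) (f : R -> R -> V) b c :
    (forall v, linear (f^~ v)) -> (forall u, linear (f u)) ->
  \sum_i f (b * x i * c) (y i) = \sum_i f (x i) (c * y i * b).
Proof.
case: dual_xy => dualx dualy lin1 lin2.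
under eq_bigr => i _ do
  rewrite [b * _ * _]dualx (linear_combination _ _ (lin1 _)).
rewrite exchange_big; apply: eq_bigr => j _ /=.
rewrite [c * _ * _]dualy (linear_combination _ _ (lin2 _)).
by apply: eq_bigr => i _; rewrite -!mulrA regtraceC -!mulrA.
Qed.

Section Conjugation.

(* A is an R-R-bimodule through phi; both the inclusion of R into a larger
   algebra and the identity of R are of interest. *)
Variables (A : algType F) (phi : {linear R -> A}).
Hypothesis phiM : {morph phi : a b / a * b}.

Definition casimir_conj (a : A) := \sum_i phi (x i) * a * phi (y i).

Lemma casimir_conj_is_linear : linear casimir_conj.
Proof.
move=> c a b; rewrite scaler_sumr -big_split; apply: eq_bigr => i _ /=.
by rewrite mulrDr mulrDl -scalerAr -scalerAl.
Qed.
HB.instance Definition _ :=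
  GRing.isLinear.Build F A A _ casimir_conj casimir_conj_is_linear.

Lemma casimir_conj_swap b c a :
  \sum_i phi (b * x i * c) * a * phi (y i) =
    \sum_i phi (x i) * a * phi (c * y i * b).
Proof.
apply: (@casimir_swap A (fun u v => phi u * a * phi v)) => u d v w.
  by rewrite linearP !mulrDl -!scalerAl.
by rewrite linearP mulrDr -scalerAr.
Qed.

Lemma casimir_conj_comm b a : phi b * casimir_conj a = casimir_conj a * phi b.
Proof.
have := casimir_conj_swap b 1 a; rewrite mulr_sumr mulr_suml => swap_b.
transitivity (\sum_i phi (b * x i * 1) * a * phi (y i)).
  by apply: eq_bigr => i _; rewrite mulr1 phiM !mulrA.
by rewrite swap_b; apply: eq_bigr => i _; rewrite mul1r phiM !mulrA.
Qed.

Lemma casimir_conjC b a : casimir_conj (a * phi b) = casimir_conj (phi b * a).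
Proof.
transitivity (\sum_i phi (1 * x i * b) * a * phi (y i)).
  rewrite casimir_conj_swap; apply: eq_bigr => i _.
  by rewrite mulr1 phiM !mulrA.
by apply: eq_bigr => i _; rewrite mul1r phiM !mulrA.
Qed.

End Conjugation.

(* the projection of R onto its centre *)
Local Notation P := (casimir_conj idfun).

(** For R = M_d(k) this is 1/d^2: the Casimir tensor of the regular trace form
    is then the sum over r, s of (1/d) e_rs (x) e_sr, and P maps e_rs to its
    trace divided by d. *)
Definition casimir_value := \sum_i P (x i) * y i.

Lemma casimir_value_comm b : b * casimir_value = casimir_value * b.
Proof.
have lin1 v : linear (fun u => P u * v).
  by move=> c u w; rewrite linearP mulrDl -scalerAl.
have lin2 u : linear (fun v => P u * v).
  by move=> c v w; rewrite mulrDr -scalerAr.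
have Pcomm a : b * P a = P a * b by apply: (casimir_conj_comm (phi := idfun)).
transitivity (\sum_i P (1 * x i * b) * y i).
  rewrite (casimir_swap 1 b lin1 lin2) mulr_sumr; apply: eq_bigr => i _.
  by rewrite mulr1 !mulrA Pcomm.
transitivity (\sum_i P (b * x i * 1) * y i).
  by apply: eq_bigr => i _; rewrite mul1r mulr1 (casimir_conjC (phi := idfun)).
rewrite (casimir_swap b 1 lin1 lin2) mulr_suml; apply: eq_bigr => i _.
by rewrite mul1r mulrA.
Qed.

(** Every element of A that commutes with the image of Z(R) is, up to
    casimir_value, an R-linear combination of elements centralising R. Summing
    first over the index of the inner conjugation turns x_i, surrounded by
    x_j and y_j, into the central element P (x_i), which a can cross. *)
Lemma casimir_reconstruction (A : algType F) (phi : {linear R -> A}) a :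
    {morph phi : b c / b * c} ->
    (forall z, (forall b, z * b = b * z) -> phi z * a = a * phi z) ->
  \sum_i phi (x i) * casimir_conj phi (phi (y i) * a) = a * phi casimir_value.
Proof.
move=> phiM centr.
transitivity (\sum_i \sum_j phi (x j * x i * y j) * a * phi (y i)).
  rewrite exchange_big /=; apply: eq_bigr => i _; rewrite mulr_sumr.
  by apply: eq_bigr => j _; rewrite !phiM !mulrA.
rewrite linear_sum mulr_sumr; apply: eq_bigr => i _.
rewrite phiM mulrA -centr => [|b]; last first.
  by rewrite (casimir_conj_comm (phi := idfun)).
by rewrite linear_sum !mulr_suml.
Qed.

Hypothesis charF : [pchar F] =i pred0.
Hypothesis ssR : semisimple_algebra R.
Hypothesis traceE :
  forall f : 'End(R), lftrace f = \sum_i regtrace (f (x i) * y i).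

(** Both sides have the same regular trace against every b: the trace of left
    multiplication by b, computed in dual bases, is the sum of the
    t(b x_i y_i). *)
Lemma casimir_sum1 : \sum_i x i * y i = 1.
Proof.
apply/eqP; rewrite -subr_eq0; apply/eqP.
apply: (regtrace_nondegenerate charF ssR) => b.
rewrite mulrBl linearB mul1r /= [X in _ - X]/regtrace traceE.
rewrite mulr_suml linear_sum.
apply/eqP; rewrite subr_eq0; apply/eqP; apply: eq_bigr => i _.
by rewrite lfunE /= regtraceC !mulrA.
Qed.

Lemma casimir_conj_central w a :
  (forall b, w * b = b * w) -> P (w * a) = w * P a.
Proof.
move=> wC; rewrite mulr_sumr; apply: eq_bigr => i _ /=.
by rewrite !mulrA -wC.
Qed.

(** The trace of b |-> u P(b) is t(u casimir_value), and for a central w the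
    powers of b |-> w P(b) are b |-> w^i P(b), as P is an idempotent that
    commutes with w. If casimir_value * w = 0, these traces vanish, so w^i = 0
    for some i; a semisimple algebra has no central nilpotents except 0. *)
Lemma casimir_value_regular w :
  (forall b, w * b = b * w) -> casimir_value * w = 0 -> w = 0.
Proof.
move=> wC mw0; pose f : 'End(R) := linfun (w \*o P).
have P1 : P 1 = 1.
  by rewrite -[RHS]casimir_sum1; apply: eq_bigr => i _; rewrite /= mulr1.
have PP a : P (P a) = P a.
  rewrite -{1}[P a]mulr1 casimir_conj_central ?P1 ?mulr1 // => b.
  by rewrite (casimir_conj_comm (phi := idfun)).
have fE i a : iter i.+1 f a = w ^+ i.+1 * P a.
  elim: i => [|i IHi]; first by rewrite /= /f lfunE.
  rewrite iterS IHi /f lfunE /= casimir_conj_central ?PP ?mulrA -?exprS // => b.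
  by apply/esym; apply: commrX; apply/esym.
have [i g gE|m nil_m] := @lftrace_nilpotent _ charF _ f.
  rewrite traceE -linear_sum /=.
  rewrite (eq_bigr (fun j => w ^+ i.+1 * (P (x j) * y j))); last first.
    by move=> j _; rewrite gE fE mulrA.
  by rewrite -mulr_sumr exprSr -mulrA wC mw0 mulr0 linear0.
apply: (semisimple_mul_nil_eq0 ssR) => b; exists m.+1.
rewrite exprMn_comm; last exact/esym.
by rewrite -[w ^+ _]mulr1 -P1 -fE iterS nil_m linear0 mulr0.
Qed.

(** Multiplication by casimir_value is an injective endomorphism of the centre,
    which is finite dimensional, so 1 is in its image. *)
Lemma casimir_value_central_inverse :
  exists2 m', forall b, m' * b = b * m' & casimir_value * m' = 1.
Proof.
pose Z := 'Z({:R})%VS.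
have ZP a : reflect (forall b, a * b = b * a) (a \in Z).
  rewrite /Z memv_cap memvf; apply: (iffP idP) => [/centvP aC b | aC].
    by apply: aC; rewrite memvf.
  by apply/centvP=> b _.
have mZ : (amulr casimir_value @: Z <= Z)%VS.
  apply/subvP=> _ /memv_imgP[z /ZP zC ->]; rewrite lfunE /=; apply/ZP => b.
  by rewrite -mulrA -casimir_value_comm !mulrA zC.
have : (amulr casimir_value @: Z)%VS = Z.
  apply/eqP; rewrite -(dimv_leqif_eq mZ).
  rewrite limg_dim_eq //; apply/eqP; rewrite -subv0; apply/subvP => z.
  rewrite memv_cap memv_ker lfunE /= => /andP[/ZP zC /eqP zm0].
  by rewrite memv0 (casimir_value_regular zC) // -zC.
have Z1 : 1 \in Z by apply/ZP => b; rewrite mul1r mulr1.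
move=> mZE; move: Z1; rewrite -mZE => /memv_imgP[m' /ZP m'C].
rewrite lfunE /= => m1.
by exists m'; rewrite // -casimir_value_comm.
Qed.

End Casimir.

(** * Split surjections of bimodules *)

Section KernelBimodule.

Variables (F : fieldType) (R : algType F) (P M : bimodule R).
Variable g : {linear P -> M}.
Hypothesis g_lact : forall b u, g (lact b u) = lact b (g u).
Hypothesis g_ract : forall u b, g (ract u b) = ract (g u) b.

Definition kernel_pred : {pred P} := [pred u | g u == 0].

Lemma kernel_submod_closed : submod_closed kernel_pred.
Proof.
split=> [|c u v]; rewrite !inE ?linear0 // => /eqP gu /eqP gv.
by rewrite linearP gu gv scaler0 addr0.
Qed.
HB.instance Definition _ :=
  GRing.isSubmodClosed.Build F P kernel_pred kernel_submod_closed.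

Record kernel_type :=
  KernelElt { kernel_val : P; _ : kernel_val \in kernel_pred }.
HB.instance Definition _ := [isSub of kernel_type for kernel_val].
HB.instance Definition _ := [Choice of kernel_type by <:].
HB.instance Definition _ := [SubChoice_isSubLmodule of kernel_type by <:].

Lemma lact0 (N : bimodule R) b : lact b (0 : N) = 0.
Proof. by have := lact_linearr b (-1) (0 : N) 0; rewrite !scaleN1r !addNr. Qed.

Lemma ract0 (N : bimodule R) b : ract (0 : N) b = 0.
Proof. by have := ract_linearl b (-1) (0 : N) 0; rewrite !scaleN1r !addNr. Qed.

Lemma kernel_lact b u : u \in kernel_pred -> lact b u \in kernel_pred.
Proof. by rewrite !inE g_lact => /eqP ->; rewrite lact0. Qed.

Lemma kernel_ract u b : u \in kernel_pred -> ract u b \in kernel_pred.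
Proof. by rewrite !inE g_ract => /eqP ->; rewrite ract0. Qed.

Definition kernel_bimod : bimodule R.
Proof.
refine (@Bimodule F R kernel_type
  (fun b u => KernelElt (kernel_lact b (valP u)))
  (fun u b => KernelElt (kernel_ract b (valP u))) _ _ _ _ _ _ _ _ _).
- by move=> u c b d; apply: val_inj; apply: lact_linearl.
- by move=> b c u v; apply: val_inj; apply: lact_linearr.
- by move=> b c u v; apply: val_inj; apply: ract_linearl.
- by move=> u c b d; apply: val_inj; apply: ract_linearr.
- by move=> u; apply: val_inj; apply: lact1.
- by move=> b c u; apply: val_inj; apply: lactM.
- by move=> u; apply: val_inj; apply: ract1.
- by move=> u b c; apply: val_inj; apply: ractM.
- by move=> b u c; apply: val_inj; apply: lractA.
Defined.

(** If f is a section of g, then u |-> (g u, u - f (g u)) is an isomorphism from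
    P to the sum of M and the kernel of g, with inverse (v, w) |-> f v + w. *)
Lemma split_direct_summand (f : {linear M -> P}) :
    (forall b u, f (lact b u) = lact b (f u)) ->
    (forall u b, f (ract u b) = ract (f u) b) ->
    cancel f g -> iso_direct_summand M P.
Proof.
move=> f_lact f_ract fK; exists kernel_bimod.
have kerB u : u - f (g u) \in kernel_pred by rewrite inE linearB fK subrr.
pose h u : sum_bimod M kernel_bimod := (g u, KernelElt (kerB u)).
have lin_h : linear h.
  move=> c u v; congr pair; first exact: linearP.
  by apply: val_inj; rewrite /= !linearP scalerDr addrACA.
pose hL : {linear P -> sum_bimod M kernel_bimod} :=
  HB.pack h (GRing.isLinear.Build F P (sum_bimod M kernel_bimod) _ h lin_h).
have lactB (N : bimodule R) b (u v : N) : lact b (u - v) = lact b u - lact b v.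
  by rewrite addrC -scaleN1r lact_linearr scaleN1r addrC.
have ractB (N : bimodule R) b (u v : N) : ract (u - v) b = ract u b - ract v b.
  by rewrite addrC -scaleN1r ract_linearl scaleN1r addrC.
exists hL; split.
- exists (fun w : sum_bimod M kernel_bimod => f w.1 + val w.2).
    by move=> u; rewrite /= addrC subrK.
  move=> [u [v kv]].
  have gv : g v = 0 by apply/eqP.
  congr pair; first by rewrite /= linearD fK gv addr0.
  by apply: val_inj; rewrite /= linearD fK gv addr0 addrAC subrr add0r.
- move=> b u; congr pair; first exact: g_lact.
  by apply: val_inj; rewrite /= g_lact f_lact lactB.
- move=> u b; congr pair; first exact: g_ract.
  by apply: val_inj; rewrite /= g_ract f_ract ractB.
Qed.

End KernelBimodule.

(** * Depth one extensions and centres *)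

Section Extension.

Variables (F : fieldType) (A : falgType F) (B : {aspace A}) (B1 : 1 \in B).

Lemma vsvalM : {morph (vsval : subvs_of B -> A) : b c / b * c}.
Proof. by []. Qed.

Lemma depth_one_center : depth_one B1 -> ('Z(B) <= 'Z({:A}))%VS.
Proof.
case=> n _ [N [f [[f' fK f'K] f_lact f_ract]]].
apply/subvP=> z; rewrite !memv_cap memvf => /andP[Bz /centvP zC].
apply/centvP=> a _.
pose w : sum_bimod (extension_bimod B1) N := (a, 0).
have lr : lact (Subvs Bz) (f' w) = ract (f' w) (Subvs Bz).
  apply/ffunP=> i; rewrite !ffunE; apply: val_inj => /=.
  by apply: zC; apply: subvsP.
have := congr1 (fun u => (f u).1) lr.
by rewrite /= f_lact f_ract f'K.
Qed.

Hypothesis charF : [pchar F] =i pred0.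
Hypothesis ssB : semisimple_algebra (subvs_of B).

(** The witness for depth one is n = dim C, with C the centraliser of B in A;
    here c_j is a basis of C and E is the projection of A onto C given by the
    Casimir tensor of B. *)
Lemma center_depth_one : ('Z(B) <= 'Z({:A}))%VS -> depth_one B1.
Proof.
move=> ZBA.
have [n [x [y [dual_xy traceE]]]] := semisimple_dual_bases charF ssB.
have [m' m'C mm'1] := casimir_value_central_inverse dual_xy charF ssB traceE.
have centr (z : subvs_of B) : (forall b, z * b = b * z) ->
    forall a : A, vsval z * a = a * vsval z.
  move=> zC a; have : vsval z \in 'Z({:A})%VS.
    apply: (subvP ZBA); rewrite memv_cap subvsP /=; apply/centvP=> b Bb.
    by have := congr1 vsval (zC (Subvs Bb)).
  by rewrite memv_cap => /andP[_ /centvP]; apply; rewrite memvf.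
pose C := 'C(B)%VS; pose c := vbasis C.
pose E : {linear A -> A} := casimir_conj x y (vsval : subvs_of B -> A).
have EC a : E a \in C.
  apply/centvP=> b Bb.
  by rewrite -[b]/(vsval (Subvs Bb)) (casimir_conj_comm dual_xy vsvalM).
have cC (j : 'I_(\dim C)) b : b \in B -> c`_j * b = b * c`_j.
  by apply/centvP/(vbasis_mem (mem_nth _ _)); rewrite size_tuple.
(* the components of the section A -> B^n *)
pose h j (a : A) := \sum_i coord c j (E (vsval (y i) * a)) *: x i.
pose H j a (u v : subvs_of B) : subvs_of B := coord c j (E (vsval v * a)) *: u.
have lin1 j a v : linear (fun u => H j a u v).
  by move=> d u w; rewrite /H scalerDr !scalerA mulrC.
have lin2 j a u : linear (H j a u).
  move=> d v w; rewrite /H linearP mulrDl -scalerAl.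
  by rewrite !linearP scalerDl scalerA.
have hl j b a : h j (vsval b * a) = b * h j a.
  have := casimir_swap dual_xy b 1 (lin1 j a) (lin2 j a); rewrite /H mulr_sumr.
  under eq_bigr => i _ do rewrite mulr1 scalerAr.
  by move=> ->; apply: eq_bigr => i _; rewrite mul1r mulrA.
have hr j b a : h j (a * vsval b) = h j a * b.
  have := casimir_swap dual_xy 1 b (lin1 j a) (lin2 j a); rewrite /H mulr_suml.
  under eq_bigr => i _ do rewrite mul1r scalerAl.
  move=> ->; apply: eq_bigr => i _; rewrite mulr1 mulrA.
  by rewrite /E /= (casimir_conjC dual_xy vsvalM) mulrA.
have h_lin j : linear (h j).
  move=> d a b; rewrite /h scaler_sumr -big_split; apply: eq_bigr => i _ /=.
  by rewrite mulrDr -scalerAr !linearP scalerDl scalerA.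
pose Bn := power_bimod (regular_bimod (subvs_of B)) (\dim C).
pose f (a : extension_bimod B1) : Bn := [ffun j => h j a].
pose g (u : Bn) : extension_bimod B1 := \sum_j vsval (u j) * (c`_j * vsval m').
have lin_f : linear f by move=> d a b; apply/ffunP=> j; rewrite !ffunE h_lin.
have lin_g : linear g.
  move=> d u v; rewrite /g scaler_sumr -big_split; apply: eq_bigr => j _ /=.
  by rewrite !ffunE linearP mulrDl -scalerAl.
exists (\dim C); first exact: adim_gt0.
apply: (@split_direct_summand _ _ _ _
  (HB.pack g (GRing.isLinear.Build F Bn (extension_bimod B1) _ g lin_g)) _ _
  (HB.pack f (GRing.isLinear.Build F (extension_bimod B1) Bn _ f lin_f))).
- move=> b u; rewrite /= /g mulr_sumr; apply: eq_bigr => j _.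
  by rewrite ffunE /= mulrA.
- move=> u b; rewrite /= /g mulr_suml; apply: eq_bigr => j _.
  rewrite ffunE /= -!mulrA (centr m') // [in RHS](mulrA c`_j).
  by rewrite cC ?subvsP // -mulrA.
- by move=> b a; apply/ffunP=> j; rewrite /= !ffunE hl.
- by move=> a b; apply/ffunP=> j; rewrite /= !ffunE hr.
(* g (f a) = sum_i x_i E (y_i a) m' = a m m' = a *)
move=> a; rewrite /= /g.
transitivity (\sum_i vsval (x i) * E (vsval (y i) * a) * vsval m').
  rewrite (eq_bigr (fun j => \sum_i vsval (x i) *
     (coord c j (E (vsval (y i) * a)) *: c`_j) * vsval m')); last first.
    move=> j _; rewrite ffunE /h linear_sum mulr_suml; apply: eq_bigr => i _ /=.
    by rewrite -scalerAl -scalerAr -scalerAl mulrA.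
  rewrite exchange_big; apply: eq_bigr => i _ /=.
  rewrite -mulr_suml -mulr_sumr; congr (_ * _ * _).
  by apply/esym; exact: coord_vbasis (EC _).
rewrite -mulr_suml (casimir_reconstruction dual_xy vsvalM); last first.
  by move=> z /centr.
rewrite -mulrA -vsvalM mm'1 /=.
by rewrite (_ : algid B = 1) ?mulr1 //; apply/eqP; rewrite algid_eq1.
Qed.

End Extension.

Theorem theorem2p5 (k : closedFieldType) (pchar_k : [pchar k] =i pred0)
    (A : falgType k) (B : {aspace A}) (B1 : 1 \in B)
    (ssA : semisimple_algebra A) (ssB : semisimple_algebra (subvs_of B)) :
  depth_one B1 <-> ('Z(B) <= 'Z({:A}))%VS.
Proof.
split; first exact: depth_one_center.
exact: center_depth_one.
Qed.
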